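(* Every compact, monotonically normal, $nwd$-separable space has a $\sigma$-disjoint $\pi$-base.
   Context: A space is $nwd$-separable if it has a dense subset which is a countable union of nowhere dense sets. A $\pi$-base is $\sigma$-disjoint if it is a countable union of families of pairwise disjoint open sets. *)

(* Defs.v *)
From mathcomp Require Import all_boot all_order.
From mathcomp Require Import all_classical.
From mathcomp Require Import topology.
Set Implicit Arguments. Unset Strict Implicit. Unset Printing Implicit Defensive.
Local Open Scope classical_set_scope.

Definition nowhere_dense {T : topologicalType} (A : set T) : Prop :=
  interior (closure A) = set0.

(* nwd-separable: there is a dense set which is a countable union of
   nowhere dense sets (countable family indexed by nat; finite/empty
   families are covered by repeating or using empty sets). *)
Definition nwd_separable (T : topologicalType) : Prop :=
  exists N : nat -> set T,
    (forall n, nowhere_dense (N n)) /\ dense (\bigcup_n N n).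

Definition monotonically_normal (T : topologicalType) : Prop :=
  accessible_space T /\
  exists G : T -> set T -> set T,
    (forall x U, open U -> U x -> open (G x U) /\ G x U x /\ G x U `<=` U) /\
    (forall x y U V, open U -> U x -> open V -> V y ->
       G x U `&` G y V !=set0 -> V x \/ U y).

Definition pi_base {T : topologicalType} (B : set (set T)) : Prop :=
  (forall b, B b -> open b /\ b !=set0) /\
  (forall U, open U -> U !=set0 -> exists2 b, B b & b `<=` U).

Definition sigma_disjoint {T : Type} (B : set (set T)) : Prop :=
  exists F : nat -> set (set T),
    B = \bigcup_n F n /\
    (forall n b c, F n b -> F n c -> b <> c -> b `&` c = set0).

(* Main.v *)
Require Import Defs.
From mathcomp Require Import all_boot all_order all_classical topology.
Local Open Scope classical_set_scope.

(** Fix a monotone normality operator [G].  Given a closed nowhere dense [N],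
    let [F0] be a maximal disjoint family of open sets [t] lying in some
    [G x (~` N)] with [x] outside [N], and [F1] a maximal disjoint family of open sets [s]
    lying in some [G x t] with [x \in t \in F0].  Every open [U] meeting [N],
    say at [y], contains a member of [F1].  Indeed every neighbourhood [V] of
    [y] gives an [s] in [F1] meeting [G y V], hence with base point [x] in [V];
    were no such [s] inside [U], then by compactness points of [s] outside [U]
    would cluster at some [z <> y] while the base points converge to [y].
    If [z] lies outside the union of [F0], the normality operator at [z]
    excludes this; if [z \in t \in F0], then [y] is in the closure of [t],
    which the normality operator at [y] excludes.  Applying this to the
    closures of countably many nowhere dense sets with dense union gives the
    pi-base. *)

Definition normality_operator {T : topologicalType}
    (G : T -> set T -> set T) : Prop :=
  (forall x U, open U -> U x -> open (G x U) /\ G x U x /\ G x U `<=` U) /\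
  (forall x y U V, open U -> U x -> open V -> V y ->
     G x U `&` G y V !=set0 -> V x \/ U y).

(** A [p] missing every member of [F] could be added to [F]; being nonempty, it is not already
    there, since it would meet itself. *)
Lemma maximal_disjoint_meets (T : Type) (P : set (set T)) :
  (forall p, P p -> p !=set0) ->
  exists F : set (set T), [/\ F `<=` P,
    trivIset F id & forall p, P p -> exists2 s, F s & s `&` p !=set0].
Proof.
move=> P0; have [F [FP tF maxF]] := ex_maximal_disjoint_subcollection id P.
exists F; split=> // p Pp; apply: contrapT => nmeet.
have Fp : ~ F p.
  by move=> Fp; apply: nmeet; exists p => //; rewrite setIid; exact: P0.
have [] := maxF (F `|` [set p]).
- by split; [exact: subsetUl | move=> /(_ p (or_intror erefl))].
- by move=> s [/FP|->].
- move=> s t [Fs|->] [Ft|->] //= st0.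
  + exact: tF.
  + by exfalso; apply: nmeet; exists s.
  + by exfalso; apply: nmeet; exists t; rewrite 1?setIC.
Qed.

Section NormalityOperator.
Context {T : topologicalType} {G : T -> set T -> set T}.
Context (T1 : accessible_space T) (GP : normality_operator G).

Let G_open {x U} : open U -> U x -> open (G x U).
Proof. by move=> oU Ux; have [] := GP.1 x U oU Ux. Qed.

Let G_mem {x U} : open U -> U x -> G x U x.
Proof. by move=> oU Ux; have [_ []] := GP.1 x U oU Ux. Qed.

Let G_sub {x U} : open U -> U x -> G x U `<=` U.
Proof. by move=> oU Ux; have [_ []] := GP.1 x U oU Ux. Qed.

Let open_setC1 (x : T) : open (~` [set x]).
Proof. by rewrite openC; exact: accessible_closed_set1. Qed.

Let G_nbhs {x U} : open U -> U x -> nbhs x (G x U).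
Proof.
by move=> oU Ux; apply: open_nbhs_nbhs; split; [exact: G_open | exact: G_mem].
Qed.

(** A common point would put [y] in [W] or make [x] differ from itself. *)
Lemma operator_away {W : set T} {x y : T} : open W -> W x -> ~ W y ->
  G x W `&` G y (~` [set x]) = set0.
Proof.
move=> oW Wx nWy; apply/eqP/negPn/negP => /set0P.
have yx : (~` [set x]) y by move=> yx; apply: nWy; rewrite yx.
by move=> /(GP.2 _ _ _ _ oW Wx (open_setC1 x) yx) [|//]; exact.
Qed.

Definition refining (C : set (set T)) : set (set T) :=
  [set s | [/\ open s, s !=set0 &
    exists t x, [/\ C t, t x & s `<=` G x t]]].

Lemma refining_meets (C : set (set T)) (U : set T) :
  (forall t, C t -> open t) -> open U ->
  (exists2 t, C t & t `&` U !=set0) -> exists2 s, refining C s & s `<=` U.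
Proof.
move=> oC oU [t Ct [x [tx Ux]]]; exists (U `&` G x t); last by move=> z [].
split; first by apply: openI => //; apply: G_open => //; exact: oC.
- by exists x; split => //; apply: G_mem => //; exact: oC.
- by exists t, x; split.
Qed.

Lemma maximal_refinement (C : set (set T)) :
  (forall t, C t -> open t) ->
  (forall U, open U -> U !=set0 -> exists2 t, C t & t `&` U !=set0) ->
  exists F : set (set T), [/\ F `<=` refining C, trivIset F id &
    forall U, open U -> U !=set0 -> exists2 s, F s & s `&` U !=set0].
Proof.
move=> oC dC; have [|F [FC tF mF]] := @maximal_disjoint_meets T (refining C).
  by move=> s [].
exists F; split=> // U oU U0.
have [p Cp pU] := refining_meets C U oC oU (dC U oU U0).
by have [s Fs [z [sz /pU Uz]]] := mF p Cp; exists s => //; exists z.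
Qed.

Lemma disjoint_pi_base_at (N : set T) : compact [set: T] -> closed N ->
  nowhere_dense N ->
  exists F : set (set T), [/\ trivIset F id,
    forall s, F s -> open s /\ s !=set0 &
    forall U, open U -> U `&` N !=set0 -> exists2 s, F s & s `<=` U].
Proof.
move=> cT cN nN; pose W := ~` N.
have oW : open W by rewrite openC.
have dW U : open U -> U !=set0 -> exists2 t, [set W] t & t `&` U !=set0.
  move=> oU [x Ux]; exists W => //; apply: contrapT => nWU.
  suff : interior (closure N) x by rewrite nN.
  rewrite -((closure_id N).1 cN).
  apply: filterS (open_nbhs_nbhs (conj oU Ux)) => z Uz.
  by apply: contrapT => Nz; apply: nWU; exists z.
have [|F0 [F0W tF0 mF0]] := maximal_refinement [set W] _ dW.
  by move=> t ->.
have oF0 t : F0 t -> open t by move=> /F0W[].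
have [F1 [F1F0 tF1 mF1]] := maximal_refinement F0 oF0 mF0.
have F0N t : F0 t -> t `<=` W.
  by move=> /F0W[_ _ [_ [x [-> Wx tG]]]]; exact: subset_trans tG (G_sub oW Wx).
exists F1; split=> //; first by move=> s /F1F0[].
move=> U oU [y [Uy Ny]]; apply: contrapT => nU.
have cU : compact (~` U).
  by apply: subclosed_compact cT _ => //; rewrite closedC.
(* Compactness of the complement of [U] makes one neighbourhood of [y] serve all [z], so it suffices
   to work near each pair of [z] and [y]. *)
have : \forall v \near y, ~` U `<=` [set z | forall t s, F0 t -> t v ->
    s `<=` G v t -> ~ s z].
  move/compact_near_coveringP : cU; apply => z nUz.
  have [[t0 F0t0 t0z]|nz] := pselect (exists2 t, F0 t & t z).
    have [_ _ [_ [x0 [-> Wx0 t0G]]]] := F0W _ F0t0.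
    have yx0 : (~` [set x0]) y by move=> yx; apply: Wx0; rewrite -yx.
    (* Near [z] only [t0] can occur as [t], and it lies in [G x0 W], which is disjoint from this
       neighbourhood of [y]. *)
    exists (t0, G y (~` [set x0])) => /=.
      split; last exact: G_nbhs.
      by apply: open_nbhs_nbhs; split => //; exact: oF0.
    move=> -[z' v] /= [t0z' Gv] t s F0t tv sG sz'.
    have tt0 : t = t0.
      apply: tF0 => //; exists z'; split=> //.
      by apply: (G_sub (oF0 _ F0t) tv); exact: sG.
    rewrite -[False]/(set0 v) -(operator_away oW Wx0 (fun Wy => Wy Ny)).
    by split=> //; apply: t0G; rewrite -tt0.
  have yz : y <> z by move=> yz; apply: nUz; rewrite -yz.
  pose O := G z (~` [set y]).
  have oO : open O by apply: G_open => // /esym.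
  have Oz : O z by apply: G_mem => // /esym.
  (* The operator is nested at [z]: a point of [s] in [G z O] forces [t z] or [O v], and [O] misses
     the neighbourhood chosen for [v]. *)
  exists (G z O, G y (~` [set z])) => /=.
    by split; exact: G_nbhs.
  move=> -[z' v] /= [Gz' Gv] t s F0t tv sG sz'.
  have [|tz|Ov] := GP.2 z v O t oO Oz (oF0 _ F0t) tv.
  - by exists z'; split=> //; exact: sG.
  - by apply: nz; exists t.
  - have yy : ~ (~` [set y]) y by apply.
    have zy : (~` [set y]) z by move=> /esym.
    rewrite -[False]/(set0 v) -(operator_away (open_setC1 y) zy yy).
    by split.
rewrite /prop_near1 nbhsE => -[V [oV Vy] VP].
have [|s F1s [w [sw Gw]]] := mF1 (G y V) (G_open oV Vy).
  by exists y; exact: G_mem.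
have [_ _ [t [x [F0t tx sG]]]] := F1F0 _ F1s.
(* Since [t] misses [N], the base point [x] must fall in [V]. *)
have [|Vx|ty] := GP.2 x y t V (oF0 _ F0t) tx oV Vy.
- by exists w; split=> //; exact: sG.
- apply: nU; exists s => // z sz; apply: contrapT => nUz.
  exact: VP x Vx z nUz t s F0t tx sG sz.
- exact: F0N t F0t y ty Ny.
Qed.
End NormalityOperator.

Theorem theorem6p8 (T : topologicalType) :
  compact [set: T] -> monotonically_normal T -> nwd_separable T ->
  exists B : set (set T), pi_base B /\ sigma_disjoint B.
Proof.
move=> cT [T1 [G GP]] [N [nN dN]].
have nNc n : nowhere_dense (closure (N n)).
  by rewrite /nowhere_dense -((closure_id _).1 (@closed_closure _ _)); exact: nN.
have /choice[F FP] n :=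
  disjoint_pi_base_at T1 GP _ cT (@closed_closure _ (N n)) (nNc n).
exists (\bigcup_n F n); split; last first.
  exists F; split=> // n b c Fb Fc bc.
  have [tF _ _] := FP n; apply/eqP/negPn/negP => /set0P bc0.
  by apply: bc; exact: tF.
split=> [b [n _ Fb]|U oU U0]; first by have [_ + _] := FP n; apply.
have [x [Ux [n _ Nx]]] := dN U U0 oU.
have [_ _ /(_ U oU)[|s Fs sU]] := FP n.
  by exists x; split=> //; exact: subset_closure.
by exists s => //; exists n.
Qed.
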